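(* Let $a_0,a_1,c_0,c_1$ be non-negative integers, $a=a_0+a_1$, $c=c_0+c_1$. Let $\alpha,\beta\in\binom{[a]}{a_1}$ and $\gamma,\delta\in\binom{[c]}{c_1}$. Then $$\mathrm{Par}(\alpha,\gamma,\beta,\delta)=\mathrm{Par}(\beta,\gamma,\alpha,\delta)=\mathrm{Par}(\alpha,\delta,\beta,\gamma)=\mathrm{Par}(\beta,\delta,\alpha,\gamma),$$ where $\mathrm{Par}(\alpha,\gamma,\beta,\delta)$ is the number of parallelogram-shaped puzzles with SW, NW, NE, SE labels $\alpha,\gamma,\beta,\delta$.
   Context: Strings: $\binom{[n]}{k}$ denotes the set of binary strings (words in the symbols $0,1$) of length $n$ with exactly $k$ ones. Puzzles: work in the triangular lattice in the plane, whose unit edges make angles $0^\circ,60^\circ,120^\circ$ with the $x$-axis. Edge labels are the three symbols $0$, $1$, $10$ (where $10$ is a single symbol). A unit triangle (upward- or downward-pointing) with labeled edges is an allowed piece if its three labels read clockwise are $(0,0,0)$, $(1,1,1)$, or a cyclic rotation of $(1,0,10)$. Given a convex lattice polygon (sides along lattice directions, some sides possibly of length $0$) each of whose sides is labeled by a binary string, one symbol per unit edge, read clockwise around the polygon, a puzzle with this boundary is an assignment of labels to all unit lattice edges in the polygon which agrees with the prescribed labels on the boundary and for which every unit triangle in the polygon is an allowed piece. $\mathrm{Par}(\alpha,\gamma,\beta,\delta)$ is the number of puzzles on the parallelogram with sides, in clockwise order, SW (length $a$), NW (length $c$), NE (length $a$), SE (length $c$), with top and bottom angles $60^\circ$, labeled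 respectively $\alpha,\gamma,\beta,\delta$, each read clockwise. *)

(* Defs.v *)
From HB Require Import structures.
From mathcomp Require Import all_boot.

Set Implicit Arguments.
Unset Strict Implicit.
Unset Printing Implicit Defensive.

(** Binary strings: [false] is the symbol 0 and [true] is the symbol 1. *)

Definition binstr (n k : nat) : {set n.-tuple bool} :=
  [set s : n.-tuple bool | count_mem true s == k].

Variant label := L0 | L1 | L10.

Definition label_code (l : label) : option bool :=
  match l with L0 => Some false | L1 => Some true | L10 => None end.

Definition label_decode (o : option bool) : label :=
  match o with Some false => L0 | Some true => L1 | None => L10 end.

Lemma label_codeK : cancel label_code label_decode.
Proof. by case. Qed.

HB.instance Definition _ := Finite.copy label (can_type label_codeK).

Definition bit_label (b : bool) : label := if b then L1 else L0.

(** [allowed x y z]: a unit triangle whose edge labels, read clockwise, are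
    x, y, z is a puzzle piece. *)

Definition allowed (x y z : label) : bool :=
  (x, y, z) \in [:: (L0, L0, L0); (L1, L1, L1);
                    (L1, L0, L10); (L0, L10, L1); (L10, L1, L0)].

(** The a x c parallelogram with 60-degree angles at the top and bottom.  Let
    u be the unit vector at 120 degrees and v the unit vector at 60 degrees.
    The lattice points of the parallelogram are V(i,j) = i u + j v, with
    i <= a and j <= c; its bottom, left, top and right corners are V(0,0),
    V(a,0), V(a,c) and V(0,c).  Its unit edges are
      - U(i,j) = V(i,j)V(i+1,j),   i < a,  j <= c  (parallel to SW and NE),
      - W(i,j) = V(i,j)V(i,j+1),   i <= a, j < c   (parallel to NW and SE),
      - H(i,j) = V(i+1,j)V(i,j+1), i < a,  j < c   (horizontal). *)

Record labelling (a c : nat) := Labelling {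
  Ulab : {ffun 'I_a * 'I_c.+1 -> label};
  Wlab : {ffun 'I_a.+1 * 'I_c -> label};
  Hlab : {ffun 'I_a * 'I_c -> label} }.

Definition labelling_code (a c : nat) (P : labelling a c) :=
  (Ulab P, Wlab P, Hlab P).

Definition labelling_decode (a c : nat)
    (t : {ffun 'I_a * 'I_c.+1 -> label} * {ffun 'I_a.+1 * 'I_c -> label}
         * {ffun 'I_a * 'I_c -> label}) : labelling a c :=
  Labelling t.1.1 t.1.2 t.2.

Lemma labelling_codeK (a c : nat) :
  cancel (@labelling_code a c) (@labelling_decode a c).
Proof. by case. Qed.

HB.instance Definition _ (a c : nat) :=
  Finite.copy (labelling a c) (can_type (@labelling_codeK a c)).

(** The indices i and i+1 in {0, ..., n}, for i < n. *)

Definition low (n : nat) (i : 'I_n) : 'I_n.+1 := widen_ord (leqnSn n) i.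
Definition high (n : nat) (i : 'I_n) : 'I_n.+1 := lift ord0 i.

(** The horizontal edge H(i,j) is the base of an upward triangle with vertices
    V(i+1,j), V(i+1,j+1), V(i,j+1) and the top edge of a downward triangle with
    vertices V(i+1,j), V(i,j+1), V(i,j), both listed clockwise; every unit
    triangle of the parallelogram arises in this way. *)

Definition up_ok (a c : nat) (P : labelling a c) (i : 'I_a) (j : 'I_c) : bool :=
  allowed (Wlab P (high i, j)) (Ulab P (i, high j)) (Hlab P (i, j)).

Definition down_ok (a c : nat) (P : labelling a c) (i : 'I_a) (j : 'I_c) : bool :=
  allowed (Hlab P (i, j)) (Wlab P (low i, j)) (Ulab P (i, low j)).

(** The sides read clockwise: SW from bottom to left, NW from left to top, NE
    from top to right, SE from right to bottom. *)

Definition sideSW (a c : nat) (P : labelling a c) : a.-tuple label :=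
  [tuple Ulab P (i, ord0) | i < a].
Definition sideNW (a c : nat) (P : labelling a c) : c.-tuple label :=
  [tuple Wlab P (ord_max, j) | j < c].
Definition sideNE (a c : nat) (P : labelling a c) : a.-tuple label :=
  [tuple Ulab P (rev_ord i, ord_max) | i < a].
Definition sideSE (a c : nat) (P : labelling a c) : c.-tuple label :=
  [tuple Wlab P (ord0, rev_ord j) | j < c].

Definition is_puzzle (a c : nat) (alpha : a.-tuple bool) (gamma : c.-tuple bool)
    (beta : a.-tuple bool) (delta : c.-tuple bool) (P : labelling a c) : bool :=
  [&& sideSW P == map_tuple bit_label alpha,
      sideNW P == map_tuple bit_label gamma,
      sideNE P == map_tuple bit_label beta,
      sideSE P == map_tuple bit_label delta
    & [forall i, forall j, up_ok P i j && down_ok P i j]].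

Definition Par (a c : nat) (alpha : a.-tuple bool) (gamma : c.-tuple bool)
    (beta : a.-tuple bool) (delta : c.-tuple bool) : nat :=
  #|[set P : labelling a c | is_puzzle alpha gamma beta delta P]|.

(* Main.v *)
(** Cut the parallelogram into c strips parallel to the SW side, and give the
    j-th strip a spectral parameter z_j which weighs the equivariant rhombus of
    Knutson and Tao; z = 0 gives back the ordinary puzzles.  Let T_xy(z) be the
    operator, on words along the SW direction, of a strip with end labels x, y.

    By the Yang-Baxter equation, exchanging two adjacent strips costs only terms
    in which their end labels are exchanged.  If z_1, ..., z_c are distinct, this
    expresses any product of T_xy(z_j) through products whose lower end labels
    read 0...01...1.  Between binary words T_11 = 1 and T_01 = 0, so such a
    product is 0 or a product of operators T_00(z_j).  These commute, and T_00(z)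
    is invariant under the half-turn of the strip; hence the whole partition
    function is symmetric in alpha and beta.  Taking z_j to be distinct powers of
    an indeterminate and evaluating it at 0 gives the symmetry for puzzles, and
    the other equality is the half-turn of the parallelogram. *)

Require Import Defs.
From mathcomp Require Import all_boot all_algebra.
From mathcomp Require Import ring.

Set Implicit Arguments.
Unset Strict Implicit.
Unset Printing Implicit Defensive.
Import GRing.Theory.
Local Open Scope ring_scope.

(** * Transfer matrices and their products *)

(** The [(x, y)] entry of the product of the matrices [M a], [a] in [l]: the partition function of a
    row with end states [x] and [y]. *)
Fixpoint chain (R : comNzRingType) (S : finType) (A : Type)
    (M : A -> S -> S -> R) (l : seq A) (x y : S) : R :=
  if l is a :: l' then \sum_m M a x m * chain M l' m y else (x == y)%:R.

Lemma sum_delta (R : comNzRingType) (S : finType) (f : S -> R) (x : S) :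
  \sum_y (x == y)%:R * f y = f x.
Proof.
rewrite (bigD1 x) //= eqxx mul1r big1 ?addr0 // => y.
by rewrite eq_sym => /negPf->; rewrite mul0r.
Qed.

Lemma sum_delta_r (R : comNzRingType) (S : finType) (f : S -> R) (x : S) :
  \sum_y f y * (y == x)%:R = f x.
Proof. by under eq_bigr => y _ do rewrite mulrC eq_sym; exact: sum_delta. Qed.

Section Chain.
Variables (R : comNzRingType) (S : finType) (A : Type).
Implicit Types (M : A -> S -> S -> R) (l : seq A).

Lemma chain_cat M l1 l2 x y :
  chain M (l1 ++ l2) x y = \sum_m chain M l1 x m * chain M l2 m y.
Proof.
elim: l1 x => [|a l1 IH] x /=; first by rewrite sum_delta.
under eq_bigr => m _ do rewrite IH mulr_sumr.
rewrite exchange_big; apply: eq_bigr => m _ /=.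
by rewrite mulr_suml; apply: eq_bigr => k _; rewrite mulrA.
Qed.

Lemma chain_rev M l x y :
  chain M (rev l) x y = chain (fun a x y => M a y x) l y x.
Proof.
elim: l y => [|a l IH] y /=; first by rewrite eq_sym.
rewrite rev_cons -cats1 chain_cat; apply: eq_bigr => m _ /=.
by rewrite IH sum_delta_r mulrC.
Qed.

Lemma eq_chain M M' l x y :
  (forall a x y, M a x y = M' a x y) -> chain M l x y = chain M' l x y.
Proof.
by move=> eqM; elim: l x => //= a l IH x; apply: eq_bigr => m _; rewrite eqM IH.
Qed.

Lemma chain_map (B : Type) (g : B -> A) M (l : seq B) x y :
  chain M (map g l) x y = chain (fun b => M (g b)) l x y.
Proof. by elim: l x => //= b l IH x; apply: eq_bigr => m _; rewrite IH. Qed.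

Lemma chain_involution (f : S -> S) M l x y : involutive f ->
  chain M l (f x) (f y) = chain (fun a x y => M a (f x) (f y)) l x y.
Proof.
move=> fK; elim: l x => [|a l IH] x /=; first by rewrite (inj_eq (inv_inj fK)).
rewrite (reindex_inj (inv_inj fK)).
by apply: eq_bigr => m _; rewrite IH.
Qed.

(** [G] moves past one factor at a time; this spreads a local exchange relation over a whole row. *)
Lemma chain_intertwine M M' (G : S -> S -> R) l x y :
    (forall a x y, \sum_w M a x w * G w y = \sum_w G x w * M' a w y) ->
  \sum_w chain M l x w * G w y = \sum_w G x w * chain M' l w y.
Proof.
move=> MG; elim: l x => [|a l IH] x /=; first by rewrite sum_delta sum_delta_r.
transitivity (\sum_m \sum_w G x w * M' a w m * chain M' l m y).
  transitivity (\sum_m M a x m * \sum_w chain M l m w * G w y).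
    under eq_bigr => w _ do rewrite mulr_suml.
    rewrite exchange_big; apply: eq_bigr => m _ /=.
    by rewrite mulr_sumr; apply: eq_bigr => w _; rewrite mulrA.
  under eq_bigr => m _ do rewrite IH mulr_sumr.
  rewrite exchange_big /=.
  under [RHS]eq_bigr => m _ do rewrite -mulr_suml -MG mulr_suml.
  by apply: eq_bigr => m _; apply: eq_bigr => w _; rewrite mulrA.
rewrite exchange_big; apply: eq_bigr => w _ /=.
by rewrite mulr_sumr; apply: eq_bigr => m _; rewrite mulrA.
Qed.

End Chain.

Lemma rmorph_chain (R R' : comNzRingType) (h : {rmorphism R -> R'})
    (S : finType) (A : Type) (M : A -> S -> S -> R) (l : seq A) x y :
  h (chain M l x y) = chain (fun a x y => h (M a x y)) l x y.
Proof.
elim: l x => [|a l IH] x /=; first by rewrite rmorph_nat.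
by rewrite rmorph_sum; apply: eq_bigr => m _; rewrite rmorphM IH.
Qed.

Lemma sum_tupleS (R : comNzRingType) (S : finType) (n : nat)
    (f : n.+1.-tuple S -> R) :
  \sum_t f t = \sum_x \sum_(t : n.-tuple S) f [tuple of x :: t].
Proof.
rewrite pair_big /= (reindex (fun p : S * n.-tuple S => [tuple of p.1 :: p.2])) //=.
exists (fun t => (thead t, [tuple of behead t])) => [[x t] _|t _] /=.
  by congr pair; apply: val_inj.
by rewrite [RHS]tuple_eta; apply: val_inj.
Qed.

Lemma sum_tuple0 (R : comNzRingType) (S : finType) (f : 0.-tuple S -> R) :
  \sum_t f t = f [tuple].
Proof. by rewrite (big_pred1 [tuple]) // => t; apply/esym/eqP/tuple0. Qed.

(** Once the states of both rows are fixed, the letters of the shared word [m] are summed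
    independently, so two stacked rows form one row whose states are pairs. *)
Lemma chain_glue (R : comNzRingType) (S L : finType)
    (M M' : L * L -> S -> S -> R) (n : nat) (u v : n.-tuple L) x y :
  \sum_(m : n.-tuple L) chain M (zip u m) x.1 y.1 * chain M' (zip m v) x.2 y.2
  = chain (fun p x y => \sum_k M (p.1, k) x.1 y.1 * M' (k, p.2) x.2 y.2)
      (zip u v) x y.
Proof.
elim: n u v x => [|n IH] u v x.
  by rewrite sum_tuple0 (tuple0 u) (tuple0 v) /= -natrM mulnb.
case/tupleP: u => a u; case/tupleP: v => b v /=.
rewrite sum_tupleS /=.
transitivity (\sum_k \sum_w M (a, k) x.1 w.1 * M' (k, b) x.2 w.2 *
   \sum_(m : n.-tuple L) chain M (zip u m) w.1 y.1 * chain M' (zip m v) w.2 y.2).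
  apply: eq_bigr => k _.
  under [RHS]eq_bigr => w _ do rewrite mulr_sumr.
  rewrite exchange_big; apply: eq_bigr => m _ /=.
  rewrite big_distrlr pair_big /=.
  by apply: eq_bigr => w _; ring.
rewrite exchange_big; apply: eq_bigr => w _ /=.
by rewrite -IH mulr_suml.
Qed.

(** * Rhombus weights and the Yang-Baxter equation *)

(* The number of ways to fill the rhombus with low edges x (W), p.1 (U) and high
   edges w (W), p.2 (U), plus z for the equivariant rhombus. *)
Definition wt (R : comNzRingType) (z : R) (p : label * label) (x w : label) : R :=
  match x, w, p.1, p.2 with
  | L0, L0, L0, L0 | L0, L0, L10, L10 | L0, L1, L10, L1 | L0, L10, L0, L1
  | L1, L0, L1, L10 | L1, L1, L0, L0 | L1, L1, L1, L1
  | L10, L0, L1, L0 | L10, L10, L1, L1 => 1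
  | L0, L0, L1, L1 => z
  | _, _, _, _ => 0
  end.

(* The order 0 < 10 < 1. *)
Definition label_lt (x y : label) : bool :=
  match x, y with L0, L10 | L0, L1 | L10, L1 => true | _, _ => false end.

(** The R-matrix: the identity plus [d] times the exchange of the two labels, on increasing pairs
    only. *)
Definition Rmat (R : comNzRingType) (d : R) (x y : label * label) : R :=
  (x == y)%:R + (d *+ label_lt x.1 x.2) * ((x.2, x.1) == y)%:R.

Lemma sum_Rmat_l (R : comNzRingType) (d : R) x (f : label * label -> R) :
  \sum_w Rmat d x w * f w = f x + (d *+ label_lt x.1 x.2) * f (x.2, x.1).
Proof.
under eq_bigr => w _ do rewrite mulrDl -mulrA.
by rewrite big_split -mulr_sumr !sum_delta.
Qed.

Lemma sum_Rmat_r (R : comNzRingType) (d : R) y (f : label * label -> R) :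
  \sum_w f w * Rmat d w y = f y + (d *+ label_lt y.2 y.1) * f (y.2, y.1).
Proof.
rewrite (eq_bigr (fun w => f w * (w == y)%:R
   + f w * (d *+ label_lt w.1 w.2) * (w == (y.2, y.1))%:R)); last first.
  move=> w _; rewrite mulrDr mulrA; congr (_ + _ * _%:R).
  by case: w y => [a b] [a' b']; rewrite !xpair_eqE andbC.
by rewrite big_split !sum_delta_r /= [X in _ + X]mulrC.
Qed.

Lemma sum_label (R : comNzRingType) (f : label -> R) :
  \sum_k f k = f L0 + f L1 + f L10.
Proof.
rewrite (bigD1 L0) // (bigD1 L1) // (bigD1 L10) //= big1 ?addr0 ?addrA //.
by case.
Qed.

(** Two stacked rhombi exchange their parameters as [Rmat] passes them. All boundary labels are
    enumerated; polynomial identities in [z] and [z'] remain. *)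
Lemma wt_yang_baxter (R : comNzRingType) (z z' : R) (p x y : label * label) :
  \sum_w (\sum_k wt z (p.1, k) x.1 w.1 * wt z' (k, p.2) x.2 w.2)
           * Rmat (z - z') w y
  = \sum_w Rmat (z - z') x w
           * (\sum_k wt z' (p.1, k) w.1 y.1 * wt z (k, p.2) w.2 y.2).
Proof.
rewrite sum_Rmat_l sum_Rmat_r !sum_label.
case: p => u v; case: x => x1 x2; case: y => y1 y2.
case: x1; case: x2; case: y1; case: y2; rewrite /= ?mulr0n ?mulr1n ?mul0r ?addr0;
 case: u; rewrite /= ?(mul0r, add0r); case: v; rewrite /= ?(mulr0, mul0r, add0r, addr0, mulr1, mul1r) //; try ring.
Qed.

(** * Strips, grids, their half-turns and exchange relations *)

Definition strip (R : comNzRingType) (z : R) (x y : label) (u v : seq label) : R :=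
  chain (wt z) (zip u v) x y.

Definition grid (R : comNzRingType) (n : nat) (l : seq (R * (label * label)))
    (u v : n.-tuple label) : R :=
  chain (fun e (u v : n.-tuple label) => strip e.1 e.2.1 e.2.2 u v) l u v.

Definition swap (A : Type) (p : A * A) : A * A := (p.2, p.1).

Lemma zip_swap (A : Type) (s t : seq A) : map (@swap A) (zip s t) = zip t s.
Proof. by elim: s t => [|a s IH] [|b t] //=; rewrite IH. Qed.

Lemma wt_rot (R : comNzRingType) (z : R) p x w : wt z p x w = wt z (swap p) w x.
Proof. by case: p => [[] []]; case: x; case: w. Qed.

Lemma strip_rot (R : comNzRingType) (z : R) x y n (u v : n.-tuple label) :
  strip z x y u v = strip z y x (rev v) (rev u).
Proof.
rewrite /strip -[zip (rev v) _]rev_zip ?size_tuple // chain_rev.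
rewrite -(zip_swap u v) chain_map.
by apply: eq_chain => p {}x {}y; rewrite wt_rot.
Qed.

Lemma rev_tupleK (n : nat) (T : Type) : involutive (@rev_tuple n T).
Proof. by move=> t; apply: val_inj; rewrite /= revK. Qed.

(** Each strip is invariant under the half-turn, which exchanges its ends and reverses its words;
    the order of the strips is reversed as well. *)
Lemma grid_rot (R : comNzRingType) n (l : seq (R * (label * label)))
    (u v : n.-tuple label) :
  grid l u v =
  grid (rev [seq (e.1, swap e.2) | e <- l]) (rev_tuple v) (rev_tuple u).
Proof.
rewrite {2}/grid chain_rev chain_map chain_involution; last exact: rev_tupleK.
by apply: eq_chain => e x y /=; exact: strip_rot.
Qed.

Lemma grid_cons (R : comNzRingType) n e (l : seq (R * (label * label)))
    (u v : n.-tuple label) :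
  grid (e :: l) u v =
  \sum_(m : n.-tuple label) strip e.1 e.2.1 e.2.2 u m * grid l m v.
Proof. by []. Qed.

(** The R-matrix is carried from one end of the pair of strips to the other; at each end it leaves
    at most one term with the two labels exchanged. *)
Lemma strip_yang_baxter (R : comNzRingType) n (z z' : R) x1 x2 y1 y2
    (u v : n.-tuple label) :
  let two z z' x1 x2 y1 y2 :=
    \sum_(m : n.-tuple label) strip z x1 y1 u m * strip z' x2 y2 m v in
  two z z' x1 x2 y1 y2 + ((z - z') *+ label_lt y2 y1) * two z z' x1 x2 y2 y1
  = two z' z x1 x2 y1 y2 + ((z - z') *+ label_lt x1 x2) * two z' z x2 x1 y1 y2.
Proof.
have := chain_intertwine (zip u v) (x1, x2) (y1, y2) (@wt_yang_baxter R z z').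
rewrite sum_Rmat_l sum_Rmat_r /= -!chain_glue /=.
by [].
Qed.

Lemma grid_yang_baxter (R : comNzRingType) n (l1 l2 : seq (R * (label * label)))
    (z z' : R) x1 x2 y1 y2 (u v : n.-tuple label) :
  let two z z' x1 x2 y1 y2 :=
    grid (l1 ++ (z, (x1, y1)) :: (z', (x2, y2)) :: l2) u v in
  two z z' x1 x2 y1 y2 + ((z - z') *+ label_lt y2 y1) * two z z' x1 x2 y2 y1
  = two z' z x1 x2 y1 y2 + ((z - z') *+ label_lt x1 x2) * two z' z x2 x1 y1 y2.
Proof.
(* Everything outside the two adjacent strips is a common factor. *)
have gridE w w' s1 s2 t1 t2 :
    grid (l1 ++ (w, (s1, t1)) :: (w', (s2, t2)) :: l2) u v =
    \sum_(a : n.-tuple label) \sum_(b : n.-tuple label) grid l1 u a * (\sum_(m : n.-tuple label)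
       strip w s1 t1 a m * strip w' s2 t2 m b) * grid l2 b v.
  rewrite /grid chain_cat; apply: eq_bigr => a _ /=.
  under [RHS]eq_bigr => b _ do rewrite -mulrA.
  rewrite -mulr_sumr; congr (_ * _).
  under eq_bigr => m _ do rewrite mulr_sumr.
  rewrite exchange_big; apply: eq_bigr => b _ /=.
  by rewrite mulr_suml; apply: eq_bigr => m _; rewrite mulrA.
rewrite /= !gridE !mulr_sumr -!big_split; apply: eq_bigr => a _ /=.
rewrite !mulr_sumr -!big_split; apply: eq_bigr => b _ /=.
have lin (c p q r s d e g : R) : p + d * q = r + e * s ->
    c * p * g + d * (c * q * g) = c * r * g + e * (c * s * g).
  by move=> eq_pq; transitivity (c * (p + d * q) * g); [ring | rewrite eq_pq; ring].
exact/lin/strip_yang_baxter.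
Qed.

(** * Strips between binary words *)

Definition binary (x : label) : bool := x != L10.

(* A strip carrying 0 or 10 emits only bits from bits, and never reaches 1. *)
Lemma strip_binary (R : comNzRingType) (z : R) x y n (u m : n.-tuple label) :
  all binary u -> x != L1 -> ~~ (all binary m && (y != L1)) ->
  strip z x y u m = 0.
Proof.
rewrite /strip; elim: n u m x => [|n IH] u m x.
  by rewrite (tuple0 u) (tuple0 m) /= negbK => _ x1 /eqP->; rewrite (negPf x1).
case/tupleP: u => a u; case/tupleP: m => b m /= /andP[ba bu] x1 nbm.
rewrite big1 // => w _.
have [->|wt0] := eqVneq (wt z (a, b) x w) 0; first by rewrite mul0r.
rewrite IH ?mulr0 //; first by case: a b x w ba x1 wt0 {nbm} => -[] [] [] //=; rewrite eqxx.
apply: contra nbm => /andP[-> ->]; rewrite !andbT.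
by case: a b x w ba x1 wt0 => -[] [] [] //=; rewrite eqxx.
Qed.

(** On a bit, state 1 either persists and copies the bit, or drops to 0, from where [strip_binary]
    forbids a return to 1. Only the copying path survives. *)
Lemma strip11 (R : comNzRingType) (z : R) n (u m : n.-tuple label) :
  all binary u -> strip z L1 L1 u m = (u == m)%:R.
Proof.
elim: n u m => [|n IH] u m; first by rewrite (tuple0 u) (tuple0 m).
case/tupleP: u => a u; case/tupleP: m => b m /= /andP[ba bu].
rewrite /strip /= sum_label.
have s0 x : x != L1 -> chain (wt z) (zip u m) x L1 = 0.
  by move=> x1; apply: strip_binary => //; rewrite andbF.
rewrite [chain _ _ L1 _]IH // !s0 // !mulr0 add0r addr0.
have -> : (cons_tuple a u == cons_tuple b m) = (a == b) && (u == m) by [].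
by case: a b ba => -[] //= _; rewrite ?mul1r ?mul0r.
Qed.

Lemma grid_ones (R : comNzRingType) n (l : seq (R * (label * label)))
    (u v : n.-tuple label) :
  all (fun e => e.2 == (L1, L1)) l -> all binary u -> grid l u v = (u == v)%:R.
Proof.
elim: l u => [//|[z p] l IH] u /= /andP[/eqP-> ones_l] bu.
rewrite grid_cons /=; under eq_bigr => m _ do rewrite strip11 //.
by rewrite sum_delta IH.
Qed.

(** By [strip_binary] the strips of [l] pass on only binary words, on which the strips of [l'] act
    as the identity. *)
Lemma grid_zeros_ones (R : comNzRingType) n (l l' : seq (R * (label * label)))
    (u v : n.-tuple label) :
    all (fun e => e.2 == (L0, L0)) l -> all (fun e => e.2 == (L1, L1)) l' ->
  all binary u -> grid (l ++ l') u v = grid l u v.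
Proof.
move=> + ones_l'; elim: l u => [|[z p] l IH] u /=; first by move=> _; exact: grid_ones.
case/andP=> /eqP-> zeros_l bu; rewrite !grid_cons; apply: eq_bigr => m _ /=.
have [bm|nbm] := boolP (all binary m); first by rewrite IH.
by rewrite strip_binary ?mul0r // (negPf nbm).
Qed.

(** The strips before the first upper end 1 pass on only binary words, and on those a strip starting
    at 0 cannot end at 1. *)
Lemma grid_zero_one (R : comNzRingType) n (l l' : seq (R * (label * label)))
    (u v : n.-tuple label) :
    all (fun e => e.2.1 == L0) l -> has (fun e => e.2.2 == L1) l ->
  all binary u -> grid (l ++ l') u v = 0.
Proof.
elim: l u => [//|[z [x y]] l IH] u /= /andP[/eqP-> x0] one_l bu.
rewrite grid_cons big1 //= => m _.
have [yN1|] := boolP (all binary m && (y != L1)); last first.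
  by move=> nbm; rewrite strip_binary ?mul0r.
case/andP: yN1 => bm /negPf yN1; rewrite yN1 /= in one_l.
by rewrite IH ?mulr0.
Qed.

(** With all end labels 0 both correction terms of the Yang-Baxter relation vanish, so neighbouring
    strips commute. *)
Lemma grid_zeros_rcons (R : comNzRingType) n (l : seq (R * (label * label)))
    z (zs : seq R) (u v : n.-tuple label) :
  grid (l ++ [seq (w, (L0, L0)) | w <- z :: zs]) u v
  = grid (l ++ [seq (w, (L0, L0)) | w <- rcons zs z]) u v.
Proof.
elim: zs l => [//|z' zs IH] l /=.
have := grid_yang_baxter l [seq (w, (L0, L0)) | w <- zs] z z' L0 L0 L0 L0 u v.
rewrite /= mulr0n !mul0r !addr0 => ->.
by rewrite -cat_rcons (IH (rcons l _)) cat_rcons.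
Qed.

Lemma grid_zeros_rev (R : comNzRingType) n (l : seq (R * (label * label)))
    (zs : seq R) (u v : n.-tuple label) :
  grid (l ++ [seq (w, (L0, L0)) | w <- rev zs]) u v
  = grid (l ++ [seq (w, (L0, L0)) | w <- zs]) u v.
Proof.
elim: zs l => [//|z zs IH] l.
by rewrite rev_cons -grid_zeros_rcons /= -!cat_rcons IH.
Qed.

(** * Symmetry of the grid by sorting the lower end labels *)

Fixpoint inversions (s : seq label) : nat :=
  if s is x :: s' then (x == L1) * count_mem L0 s' + inversions s' else 0.

Lemma inversions_swap (s1 s2 : seq label) :
  inversions (s1 ++ L1 :: L0 :: s2) = (inversions (s1 ++ L0 :: L1 :: s2)).+1.
Proof.
elim: s1 => [|x s1 IH] /=; first by rewrite !mul1n mul0n.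
by rewrite IH !count_cat /= addnS.
Qed.

Lemma sorted_or_descent (A : Type) (f : A -> label) (l : seq A) :
    all (fun e => binary (f e)) l ->
  (exists l0 l1, [/\ l = l0 ++ l1, all (fun e => f e == L0) l0
                   & all (fun e => f e == L1) l1]) \/
  (exists l1 e e' l2, [/\ l = l1 ++ e :: e' :: l2, f e = L1 & f e' = L0]).
Proof.
elim: l => [|e l IH] /=; first by left; exists [::], [::].
case/andP=> be /IH[[l0 [l1 [-> l0P l1P]]]|[l1 [e1 [e2 [l2 [-> f1 f2]]]]]]; last first.
  by right; exists (e :: l1), e1, e2, l2.
case fe: (f e) be => // _.
  by left; exists (e :: l0), l1; rewrite /= fe.
case: l0 l0P => [|e0 l0] /=; first by left; exists [::], (e :: l1); rewrite /= fe.
by case/andP=> /eqP f0 _; right; exists [::], e, e0, (l0 ++ l1).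
Qed.

(** If some strip of [l] ends at 1, both sides vanish. Otherwise the counts force every strip of
    [l'] to have both ends 1, and only commuting strips with both ends 0 remain. *)
Lemma grid_sorted_sym (R : comNzRingType) n (l l' : seq (R * (label * label)))
    (u v : n.-tuple label) :
    all (fun e => e.2.1 == L0) l -> all (fun e => e.2.1 == L1) l' ->
    all (fun e => binary e.2.2) (l ++ l') ->
    count (fun e => e.2.1 == L1) (l ++ l') = count (fun e => e.2.2 == L1) (l ++ l') ->
    all binary u -> all binary v ->
  grid (l ++ l') u v = grid (l ++ l') (rev_tuple v) (rev_tuple u).
Proof.
move=> xl xl' by_ cnt bu bv.
have brv : all binary (rev_tuple v) by rewrite /= all_rev.
have [one_l|] := boolP (has (fun e => e.2.2 == L1) l).
  by rewrite !grid_zero_one.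
rewrite -all_predC => /allP yl.
have zeros_l : all (fun e => e.2 == (L0, L0)) l.
  apply/allP => e el; have /eqP x0 := allP xl e el.
  have := allP by_ e; rewrite mem_cat el => /(_ isT).
  by have := yl e el; case: e x0 {el} => z [x y] /= ->; case: y.
have ones_l' : all (fun e => e.2 == (L1, L1)) l'.
  (* [l] has no end label 1 on either side, so the equal counts compare [l'] alone. *)
  have c1 : count (fun e => e.2.2 == L1) l' = size l'.
    move: cnt; rewrite !count_cat.
    rewrite (eqP (_ : count _ l == 0%N)); last first.
      by rewrite eqn0Ngt -has_count -all_predC; apply: sub_all xl => -[z [x y]] /= /eqP->.
    rewrite (eqP (_ : count (fun e => e.2.2 == L1) l == 0%N)); last first.
      by rewrite eqn0Ngt -has_count -all_predC; apply/allP.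
    by rewrite !add0n => <-; apply/eqP; rewrite -all_count.
  have yl' : all (fun e => e.2.2 == L1) l' by rewrite all_count c1.
  apply/allP => -[z [x y]] el.
  by apply/eqP; congr pair; apply/eqP; [exact: (allP xl' _ el) | exact: (allP yl' _ el)].
(* The half-turn restores [u] and [v] but reverses the strips; [grid_zeros_rev] undoes this. *)
rewrite !grid_zeros_ones // [RHS]grid_rot !rev_tupleK.
have [zs ->] : exists zs, l = [seq (w, (L0, L0)) | w <- zs].
  exists (map fst l); rewrite -map_comp -[LHS]map_id; apply/eq_in_map => -[z p].
  by move/(allP zeros_l)/eqP => /= ->.
by rewrite -map_comp -map_rev; apply/esym/(grid_zeros_rev [::]).
Qed.

(** Induction on the inversions of the lower end labels. At a descent, the grid times a difference
    of two parameters is a combination of grids with one inversion fewer; the parameters being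
    distinct, that factor cancels. *)
Lemma grid_sym (R : idomainType) n (l : seq (R * (label * label)))
    (u v : n.-tuple label) :
    uniq (map fst l) -> all (fun e => binary e.2.1) l ->
    all (fun e => binary e.2.2) l ->
    count (fun e => e.2.1 == L1) l = count (fun e => e.2.2 == L1) l ->
    all binary u -> all binary v ->
  grid l u v = grid l (rev_tuple v) (rev_tuple u).
Proof.
move=> + + + + bu bv.
have [k invl] : exists k, inversions [seq e.2.1 | e <- l] = k by eexists.
elim/ltn_ind: k l invl => k IH l invl.
move=> uz bx by_ cnt.
have [[l0 [l1 [lE x0 x1]]]|[l1 [[z' [x1 y1]] [[z [x0 y0]] [l2 [lE /= x1E x0E]]]]]] :=
  sorted_or_descent bx.
  by subst l; exact: grid_sorted_sym.
subst l x1 x0.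
have dN0 : z - z' != 0.
  rewrite subr_eq0 eq_sym; move: uz; rewrite map_cat cat_uniq /= inE.
  by case/and3P=> _ _ /andP[/norP[]].
(* The relation permutes parameters and upper labels of the two strips; distinctness and counts
   survive, so one statement covers all three sorted grids. *)
have IHs w w' t t' : perm_eq [:: w; w'] [:: z; z'] -> perm_eq [:: t; t'] [:: y1; y0] ->
    let l' := l1 ++ (w, (L0, t)) :: (w', (L1, t')) :: l2 in
    grid l' u v = grid l' (rev_tuple v) (rev_tuple u).
  move=> pw pt l'.
  have {}pw : perm_eq (map fst l') (map fst (l1 ++ (z', (L1, y1)) :: (z, (L0, y0)) :: l2)).
    rewrite !map_cat perm_cat2l /=.
    apply: (@perm_trans _ ([:: z; z'] ++ map fst l2)).
      by rewrite -(perm_cat2r (map fst l2)) in pw.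
    by apply/permP => a /=; rewrite addnCA.
  have {}pt : perm_eq [seq e.2.2 | e <- l'] [seq e.2.2 | e <- l1 ++ (z', (L1, y1)) :: (z, (L0, y0)) :: l2].
    by rewrite !map_cat perm_cat2l /= -(perm_cat2r [seq e.2.2 | e <- l2]) in pt *.
  apply: (IH (inversions [seq e.2.1 | e <- l'])) => //.
  - by rewrite -invl !map_cat /= inversions_swap.
  - by rewrite (perm_uniq pw).
  - by move: bx; rewrite !all_cat /=.
  - rewrite -(all_map (fun e : R * (label * label) => e.2.2)) (perm_all _ pt).
    by rewrite all_map.
  - have := permP pt (pred1 L1); rewrite !count_map => ->.
    by rewrite -cnt !count_cat.
(* Lower labels are entered in the order 0, 1 and parameters as [z], [z'], so that the given grid is
   the last term, with coefficient [z - z']. *)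
have yb := grid_yang_baxter l1 l2 z z' L0 L1 y1 y0.
apply: (mulfI dN0).
have /= e1 := yb n u v.
have /= e2 := yb n (rev_tuple v) (rev_tuple u).
have pzz : perm_eq [:: z'; z] [:: z; z'] by apply/permP => a /=; rewrite addnCA.
have pyy : perm_eq [:: y0; y1] [:: y1; y0] by apply/permP => a /=; rewrite addnCA.
rewrite !mulr1n in e1 e2.
apply: (addrI (grid (l1 ++ [:: (z', (L0, y1)), (z, (L1, y0)) & l2]) u v)).
by rewrite -e1 (IHs z z') // (IHs z z') // (IHs z' z y1 y0) // e2.
Qed.

(** * Puzzle counts as grids with all parameters zero *)

Definition fcons (S : finType) (n : nat) (x : S) (f : {ffun 'I_n.+1 -> S}) :
    {ffun 'I_n.+2 -> S} :=
  [ffun i => if unlift ord0 i is Some j then f j else x].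

(** Expands a matrix product as a sum over paths of states, the end conditions being indicators. *)
Lemma chain_paths (R : comNzRingType) (S : finType) (A : Type)
    (M : A -> S -> S -> R) n (l : n.-tuple A) x y :
  chain M l x y =
  \sum_(f : {ffun 'I_n.+1 -> S}) ((f ord0 == x) && (f ord_max == y))%:R
    * \prod_(i < n) M (tnth l i) (f (low i)) (f (high i)).
Proof.
elim: n l x => [|n IH] l x.
  rewrite (tuple0 l) /= (reindex (fun s => [ffun _ : 'I_1 => s])) /=; last first.
    exists (fun f : {ffun 'I_1 -> S} => f ord0) => f _; first by rewrite ffunE.
    by apply/ffunP => i; rewrite ffunE (ord1 i).
  rewrite -(sum_delta (fun s => (s == y)%:R)).
  by apply: eq_bigr => s _; rewrite big_ord0 mulr1 !ffunE -natrM mulnb eq_sym.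
case/tupleP: l => a l /=.
under eq_bigr => m _ do rewrite IH mulr_sumr.
rewrite exchange_big /= (reindex (fun p => @fcons S n p.1 p.2)) /=; last first.
  exists (fun f : {ffun 'I_n.+2 -> S} => (f ord0, [ffun i => f (lift ord0 i)])).
    case=> s f _ /=; rewrite ffunE unlift_none; congr pair.
    by apply/ffunP => i; rewrite !ffunE liftK.
  move=> f _; apply/ffunP => i; rewrite ffunE.
  by case: unliftP => [j|] ->; rewrite ?ffunE.
rewrite -(pair_bigA _ (fun (s : S) (f : {ffun 'I_n.+1 -> S}) =>
  ((fcons s f ord0 == x) && (fcons s f ord_max == y))%:R * \prod_(i < n.+1)
    M (tnth [tuple of a :: l] i) (fcons s f (low i)) (fcons s f (high i)))) /=.
rewrite [RHS]exchange_big; apply: eq_bigr => f _ /=.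
have fmax s : fcons s f ord_max = f ord_max.
  by rewrite ffunE (_ : ord_max = lift ord0 ord_max) ?liftK //; apply: val_inj.
have fhigh s i : fcons s f (high i) = f i by rewrite ffunE liftK.
have flow0 s : fcons s f (low ord0) = s.
  by rewrite ffunE (_ : low _ = ord0) ?unlift_none //; apply: val_inj.
have flow s i : fcons s f (low (lift ord0 i)) = f (low i).
  by rewrite ffunE (_ : low _ = lift ord0 (low i)) ?liftK //; apply: val_inj.
have f0 s : fcons s f ord0 = s by rewrite ffunE unlift_none.
(* [T] is free of the new first state, so on each side one indicator collapses the sum: at [f ord0]
   on the left, at [x] on the right. *)
pose T := (f ord_max == y)%:R * \prod_(i < n) M (tnth l i) (f (low i)) (f (high i)).
transitivity (M a x (f ord0) * T).
  apply: etrans (sum_delta (fun s => M a x s * T) (f ord0)).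
  by apply: eq_bigr => s _; rewrite /T -mulnb natrM; ring.
apply: etrans (esym (sum_delta (fun s => M a s (f ord0) * T) x)) _.
apply: eq_bigr => s _.
rewrite f0 fmax big_ord_recl flow0 fhigh -mulnb natrM eq_sym tnth0 /T.
under [in RHS]eq_bigr => i _ do rewrite tnthS flow fhigh.
by ring.
Qed.

Lemma prod_bool (R : comNzRingType) (I : finType) (b : pred I) :
  \prod_i (b i)%:R = [forall i, b i]%:R :> R.
Proof.
have [/forallP bT|/forallPn[i /negPf bF]] := boolP [forall i, b i].
  by rewrite big1 // => i _; rewrite bT.
by rewrite (bigD1 i) //= bF mul0r.
Qed.

(** [h] labels the horizontal diagonal of the rhombus. The equivariant rhombus has no such filling,
    and its weight [z] is here 0. *)
Lemma wt0E (R : comNzRingType) p x w :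
  wt 0 p x w = \sum_h (allowed h x p.1 && allowed w p.2 h)%:R :> R.
Proof.
by rewrite sum_label; case: p => [[] []]; case: x; case: w; rewrite /= ?addr0 ?add0r.
Qed.

(* The sides are read clockwise, so delta runs against the order of the strips. *)
Definition strips (R : Type) (c : nat) (z : 'I_c -> R) (gamma delta : c.-tuple bool) :
    c.-tuple (R * (label * label)) :=
  [tuple (z j, (bit_label (tnth delta (rev_ord j)), bit_label (tnth gamma j))) | j < c].

Definition word (n : nat) (s : n.-tuple bool) : n.-tuple label := map_tuple bit_label s.

Lemma tnth_zip_tuple (A B : Type) n (u : n.-tuple A) (v : n.-tuple B) i :
  tnth (zip_tuple u v) i = (tnth u i, tnth v i).
Proof.
rewrite (tnth_nth (tnth u i, tnth v i)) nth_zip ?size_tuple //.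
by rewrite -!tnth_nth.
Qed.

Lemma tnth_rev_tuple (A : Type) n (t : n.-tuple A) i :
  tnth (rev_tuple t) i = tnth t (rev_ord i).
Proof.
pose x0 := tnth t i.
by rewrite !(tnth_nth x0) /= nth_rev size_tuple.
Qed.

(** The words on the cut lines form the path of [chain_paths]. Once they are fixed, the W and H
    labels of each strip are chosen independently of the other strips. *)
Lemma Par_grid (a c : nat) (alpha : a.-tuple bool) (gamma : c.-tuple bool)
    (beta : a.-tuple bool) (delta : c.-tuple bool) :
  (Par alpha gamma beta delta)%:R
  = grid (strips (fun=> 0) gamma delta) (word alpha) (rev_tuple (word beta)) :> int.
Proof.
rewrite /grid chain_paths /Par -sum1_card natr_sum big_mkcond /=.
pose K := ({ffun 'I_a.+1 -> label} * {ffun 'I_a -> label})%type.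
pose glue (p : {ffun 'I_c.+1 -> a.-tuple label} * {ffun 'I_c -> K}) : labelling a c :=
  Labelling [ffun q => tnth (p.1 q.2) q.1] [ffun q => (p.2 q.2).1 q.1]
            [ffun q => (p.2 q.2).2 q.1].
rewrite (reindex glue) /=; last first.
  exists (fun P => ([ffun j => [tuple Ulab P (i, j) | i < a]],
     [ffun j => ([ffun i => Wlab P (i, j)], [ffun i => Hlab P (i, j)])])).
    case=> U V _; congr pair; apply/ffunP => j; rewrite !ffunE /=.
      by apply: eq_from_tnth => i; rewrite tnth_mktuple ffunE.
    rewrite [RHS]surjective_pairing.
    by congr pair; apply/ffunP => i; rewrite !ffunE.
  case=> U W H _; congr Labelling; apply/ffunP => -[i j]; rewrite !ffunE /= ?ffunE //.
  by rewrite tnth_mktuple.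
rewrite -(pair_bigA _ (fun (U : {ffun 'I_c.+1 -> a.-tuple label}) (V : {ffun 'I_c -> K}) => if glue (U, V) \in _ then 1%:R else 0)) /=.
apply: eq_bigr => U _.
pose cell j (k : K) i := allowed (k.2 i) (k.1 (low i)) (tnth (U (low j)) i)
                      && allowed (k.1 (high i)) (tnth (U (high j)) i) (k.2 i).
pose col j (k : K) :=
  [&& k.1 ord0 == bit_label (tnth delta (rev_ord j)),
      k.1 ord_max == bit_label (tnth gamma j) & [forall i, cell j k i]].
transitivity (((U ord0 == word alpha) && (U ord_max == rev_tuple (word beta)))%:R
  * \prod_(j < c) \sum_(k : K) (col j k)%:R : int); last first.
  congr (_ * _); apply: eq_bigr => j _.
  rewrite tnth_mktuple /= /strip.
  rewrite (chain_paths _ (zip_tuple (U (low j)) (U (high j)))).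
  rewrite -(pair_bigA _ (fun (g : {ffun 'I_a.+1 -> label}) (h : {ffun 'I_a -> label}) => (col j (g, h))%:R)) /=.
  apply: eq_bigr => g _.
  under [in RHS]eq_bigr => i _ do rewrite tnth_zip_tuple wt0E /=.
  (* Distributivity turns a product over rhombi of sums over one label into a sum over all label
     functions; the same is done below over the strips. *)
  rewrite bigA_distr_bigA mulr_sumr; apply: eq_bigr => h _.
  by rewrite (prod_bool _ (cell j (g, h))) -natrM mulnb -andbA.
rewrite bigA_distr_bigA mulr_sumr; apply: eq_bigr => V _ /=.
rewrite prod_bool -natrM mulnb inE /is_puzzle.
have ifE (b : bool) : (if b then 1 else 0) = b%:R :> int by case: b.
rewrite ifE; congr (_%:R).
have -> : sideSW (glue (U, V)) = U ord0.
  by apply: eq_from_tnth => i; rewrite tnth_mktuple ffunE.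
have -> : sideNE (glue (U, V)) = rev_tuple (U ord_max).
  by apply: eq_from_tnth => i; rewrite tnth_mktuple ffunE tnth_rev_tuple.
rewrite -[rev_tuple (U ord_max) == _](inj_eq (inv_inj (@rev_tupleK a label))) rev_tupleK.
rewrite -!andbA; congr andb; rewrite andbCA; congr andb.
apply/and3P/forallP => [[/eqP NW /eqP SE /forallP cells] j|cols].
  rewrite /col; apply/and3P; split.
  - have := congr1 (fun t => tnth t (rev_ord j)) SE.
    by rewrite tnth_mktuple tnth_map ffunE /= rev_ordK => ->.
  - by have := congr1 (fun t => tnth t j) NW; rewrite tnth_mktuple tnth_map ffunE /= => ->.
  apply/forallP => i; have /forallP/(_ j) := cells i.
  by rewrite /up_ok /down_ok /cell !ffunE /= andbC.
split.
- apply/eqP/eq_from_tnth => j; rewrite tnth_mktuple tnth_map ffunE /=.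
  by case/and3P: (cols j) => _ /eqP.
- apply/eqP/eq_from_tnth => j; rewrite tnth_mktuple tnth_map ffunE /=.
  by case/and3P: (cols (rev_ord j)) => /eqP-> _ _; rewrite rev_ordK.
apply/forallP => i; apply/forallP => j.
case/and3P: (cols j) => _ _ /forallP/(_ i).
by rewrite /up_ok /down_ok /cell !ffunE /= andbC.
Qed.

(** * Specialization at zero and the symmetries of puzzle counts *)

(** Since [strips] reads its second word backwards, reversing the strips and exchanging their ends
    exchanges [gamma] and [delta]. *)
Lemma grid_swap_strips (R : comNzRingType) a c (gamma delta : c.-tuple bool)
    (u v : a.-tuple label) :
  grid (strips (fun=> 0 : R) gamma delta) u v
  = grid (strips (fun=> 0 : R) delta gamma) (rev_tuple v) (rev_tuple u).
Proof.
rewrite grid_rot; congr grid.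
rewrite -[LHS]/(tval (rev_tuple (map_tuple _ _))); congr tval.
apply: eq_from_tnth => j.
by rewrite tnth_rev_tuple tnth_map !tnth_mktuple /= rev_ordK.
Qed.

Lemma grid_transpose_words (a c : nat) (alpha beta : a.-tuple bool)
    (gamma delta : c.-tuple bool) :
  count_mem true gamma = count_mem true delta ->
  grid (strips (fun=> 0) gamma delta) (word alpha) (rev_tuple (word beta))
  = grid (strips (fun=> 0) gamma delta) (word beta) (rev_tuple (word alpha)) :> int.
Proof.
move=> cnt.
(* The exponent is [j.+1] so that the parameter of the first strip also vanishes at 0; distinct
   degrees make the parameters distinct. *)
pose Z (j : 'I_c) : {poly int} := 'X^(j.+1).
have eval0 (u v : a.-tuple label) :
    grid (strips (fun=> 0) gamma delta) u v = (grid (strips Z gamma delta) u v).[0].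
  rewrite -[RHS]/(horner_eval 0 _) /grid rmorph_chain /=.
  have -> : strips (fun=> 0) gamma delta =
      [seq (e.1.[0], e.2) | e : {poly int} * (label * label) <- strips Z gamma delta] :> seq _.
    rewrite -map_comp; apply: eq_map => j /=.
    by rewrite /Z hornerXn expr0n.
  rewrite chain_map; apply: eq_chain => e x y /=.
  rewrite /strip -[RHS]/(horner_eval 0 _) rmorph_chain; apply: eq_chain => p {}x {}y /=.
  by rewrite /horner_eval; case: p => [[] []]; case: x; case: y; rewrite /= ?hornerE.
rewrite !eval0 [in LHS]grid_sym ?rev_tupleK //.
- rewrite -map_comp map_inj_in_uniq ?enum_uniq // => i j _ _ /= eqZ.
  apply: val_inj; have := congr1 (fun p : {poly int} => size p) eqZ.
  by rewrite /Z !size_polyXn => -[].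
- by apply/allP => e /mapP[j _ ->] /=; case: (tnth _ _).
- by apply/allP => e /mapP[j _ ->] /=; case: (tnth _ _).
- have bit1 (s : seq bool) : count (pred1 L1) (map bit_label s) = count_mem true s.
    by rewrite count_map; apply: eq_count => -[].
  have bottoms : [seq e.2.1 | e <- strips Z gamma delta] = map bit_label (rev delta).
    rewrite -map_comp -[RHS]/(tval (map_tuple bit_label (rev_tuple delta))).
    rewrite -[RHS]map_tnth_enum; apply: eq_map => j /=.
    by rewrite tnth_map tnth_rev_tuple.
  have tops : [seq e.2.2 | e <- strips Z gamma delta] = map bit_label gamma.
    rewrite -map_comp -[RHS]/(tval (map_tuple bit_label gamma)).
    by rewrite -[RHS]map_tnth_enum; apply: eq_map => j /=; rewrite tnth_map.
  rewrite -(count_map (fun e => e.2.1) (pred1 L1)) bottoms bit1 count_rev -cnt -bit1 -tops.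
  by rewrite count_map.
- by apply/allP => x /mapP[b _ ->]; case: b.
- by rewrite /= all_rev; apply/allP => x /mapP[b _ ->]; case: b.
Qed.

Local Close Scope ring_scope.

Theorem theorem4 (a0 a1 c0 c1 a c : nat)
    (ha : a = a0 + a1) (hc : c = c0 + c1)
    (alpha beta : a.-tuple bool) (gamma delta : c.-tuple bool)
    (halpha : alpha \in binstr a a1) (hbeta : beta \in binstr a a1)
    (hgamma : gamma \in binstr c c1) (hdelta : delta \in binstr c c1) :
  [/\ Par alpha gamma beta delta = Par beta gamma alpha delta,
      Par beta gamma alpha delta = Par alpha delta beta gamma
    & Par alpha delta beta gamma = Par beta delta alpha gamma].
Proof.
have cnt : count_mem true gamma = count_mem true delta.
  by move: hgamma hdelta; rewrite !inE => /eqP-> /eqP->.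
have nat_int (m n : nat) : (m%:R = n%:R :> int)%R -> m = n.
  by rewrite !natz => -[].
(* The outer equalities exchange [alpha] and [beta]; the middle one is the half-turn. *)
split; apply: nat_int; rewrite !Par_grid.
- exact: grid_transpose_words.
- by rewrite grid_swap_strips rev_tupleK.
- exact: grid_transpose_words.
Qed.
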